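(* Let $k$ be an algebraically closed field, let $\ell\geq 2$ and $s\geq 1$, and let $\underline t=(t_1,\ldots,t_s)$, $\underline x=(x_1,\ldots,x_\ell)$ be indeterminates. Let $F(\underline t,\underline x)\in k[\underline t,\underline x]$ be a polynomial with Newton polyhedron $\Gamma\subset\mathbb{R}^\ell$ (as a polynomial in $\underline x$). Let $\mathcal{V}_\Gamma$ be the set of vertices of $\Gamma$, let $\mathcal{I}_\Gamma=\Gamma\cap\mathbb{N}^\ell$, and denote the coefficients of $F$ by $h_{\underline i}(\underline t)\in k[\underline t]$ ($\underline i\in\mathcal{I}_\Gamma$), so that $F=\sum_{\underline i\in\mathcal{I}_\Gamma}h_{\underline i}(\underline t)\,x_1^{i_1}\cdots x_\ell^{i_\ell}$. If $\Gamma$ is not summable, then $F(\underline t^\ast,\underline x)$ is irreducible in $k[\underline x]$ for every specialization $\underline t^\ast\in k^s$ such that $h_{\underline i}(\underline t^\ast)\neq 0$ for each $\underline i\in\mathcal{V}_\Gamma$. Consequently, with $d=\deg_{\underline x}(F)$: (i) if $s=1$, then $\mathrm{card}(\mathrm{sp}(F)\cap\mathcal{U}_F)\leq \mathrm{card}(\mathcal{V}_\Gamma)\,\deg_{t_1}(F)$; (ii) for every $i=1,\ldots,s$, the set of $t_i^\ast\in k$ such that the polynomial $F(t_1,\ldots,t_{i-1},t_i^\ast,t_{i+1},\ldots,t_s,\underline x)$ is of degree $d$ in $\underline x$ and reducible in $\overline{k(t_1,\ldots,t_{i-1},t_{i+1},\ldots,t_s)}[\underline x]$ is of cardinality $\leq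 \mathrm{card}(\mathcal{V}_\Gamma)\,\deg_{t_i}(F)$.
   Context: For a field $L$, $\overline{L}$ denotes an algebraic closure. The Newton polyhedron of a polynomial $P$ in $\underline x$ is the convex hull in $\mathbb{R}^\ell$ of the set of exponents $(i_1,\ldots,i_\ell)$ of the monomials $x_1^{i_1}\cdots x_\ell^{i_\ell}$ appearing in $P$ with non-zero coefficient. For subsets $A,B$ of $\mathbb{R}^\ell$, $A+B=\{a+b\mid a\in A,\ b\in B\}$. A convex polyhedron $\Gamma$ with vertices in $\mathbb{N}^\ell$ is summable if $\Gamma=A+B$ for two convex subsets $A$ and $B$ with integral vertices (in $\mathbb{N}^\ell$), each having at least two points. The spectrum of $F$ is $\mathrm{sp}(F)=\{\underline t^\ast\in k^s\mid F(\underline t^\ast,\underline x)\text{ is reducible in }k[\underline x]\}$, and $\mathcal{U}_F$ is the set of all $\underline t^\ast\in k^s$ such that $\deg(F(\underline t^\ast,\underline x))=\deg_{\underline x}F(\underline t,\underline x)$, where $\deg_{\underline x}$ is total degree in $\underline x$.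
   Formalization: Added hypotheses: deg_x(F) ≥ 1, and if some x_j divides F then the cofactor is constant in x; without them the claim fails, e.g. F = 1 or F = x_1(x_1+x_2), whose Γ is not summable though F is not irreducible. *)

(* Defs.v *)
From HB Require Import structures.
From mathcomp Require Import all_boot all_order all_algebra finmap.
From mathcomp Require Import boolp classical_sets functions cardinality.
From mathcomp Require Import reals convex.
From mathcomp Require Import mpoly.

Set Implicit Arguments.
Unset Strict Implicit.
Unset Printing Implicit Defensive.

Import Order.TTheory GRing.Theory Num.Theory.
Local Open Scope ring_scope.
Local Open Scope classical_set_scope.

Definition convex_hull (R : realType) (l : nat) (S : set 'rV[R]_l) :
    set 'rV[R]_l :=
  smallest (@convex_set R 'rV[R]_l) S.

Definition vertices (R : realType) (l : nat) (A : set 'rV[R]_l) :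
    set 'rV[R]_l :=
  [set v | A v /\ forall (x y : 'rV[R]_l) (c : R), A x -> A y ->
     0 < c -> c < 1 -> v = c *: x + (1 - c) *: y -> x = y].

Definition minkowski_sum (R : realType) (l : nat) (A B : set 'rV[R]_l) :
    set 'rV[R]_l :=
  [set a + b | a in A & b in B].

(* The point of R^l with coordinates the exponents of the monomial m; as m
   varies, these are exactly the points of N^l. *)
Definition expvec (R : realType) (l : nat) (m : 'X_{1..l}) : 'rV[R]_l :=
  \row_j (m j)%:R.

Definition integral_vertices (R : realType) (l : nat) (A : set 'rV[R]_l) :
    Prop :=
  forall v, vertices A v -> exists m : 'X_{1..l}, v = expvec R m.

(* If Gamma is a polytope and Gamma = A + B with A and B convex, then A and B
   are automatically polytopes, so integral_vertices cannot hold vacuously. *)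
Definition summable (R : realType) (l : nat) (Gamma : set 'rV[R]_l) : Prop :=
  exists A B : set 'rV[R]_l,
    [/\ @convex_set R 'rV[R]_l A /\ @convex_set R 'rV[R]_l B,
        integral_vertices A /\ integral_vertices B,
        exists a a', [/\ A a, A a' & a <> a'],
        exists b b', [/\ B b, B b' & b <> b']
      & Gamma = minkowski_sum A B].

(* Elements of k[t, x] are represented as polynomials in x with coefficients
   in k[t]. For any P, msize P is its total degree in x plus one, and 0 if
   P = 0. *)

Definition newton (R : realType) (l : nat) (A : nzRingType)
    (P : {mpoly A[l]}) : set 'rV[R]_l :=
  convex_hull [set expvec R m | m in [set m | m \in msupp P]].
Arguments newton R {l A} P.

Definition degt (k : closedFieldType) (l s : nat) (i : 'I_s)
    (F : {mpoly {mpoly k[s]}[l]}) : nat :=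
  (\max_(m <- msupp F) \max_(u <- msupp F@_m) u i)%N.

Definition specialize (k : closedFieldType) (l s : nat) (tstar : 'I_s -> k)
    (F : {mpoly {mpoly k[s]}[l]}) : {mpoly k[l]} :=
  map_mpoly (meval tstar) F.

(* Substitution of a for t_i; the other s - 1 variables are renumbered in
   increasing order. *)
Definition specialize1 (k : closedFieldType) (l s : nat) (i : 'I_s) (a : k)
    (F : {mpoly {mpoly k[s]}[l]}) : {mpoly {mpoly k[s.-1]}[l]} :=
  map_mpoly
    (comp_mpoly [tuple if unlift i j is Some j' then 'X_j' else a%:MP | j < s])
    F.

Definition irreducible_elt (A : idomainType) (p : A) : Prop :=
  [/\ p != 0, p \isn't a GRing.unit
    & forall q r, p = q * r -> q \is a GRing.unit \/ r \is a GRing.unit].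

Definition reducible_elt (A : idomainType) (p : A) : Prop :=
  exists q r, [/\ q \isn't a GRing.unit, r \isn't a GRing.unit & p = q * r].

Definition sp (k : closedFieldType) (l s : nat)
    (F : {mpoly {mpoly k[s]}[l]}) : set ('I_s -> k) :=
  [set tstar | reducible_elt (specialize tstar F)].

Definition degree_preserving (k : closedFieldType) (l s : nat)
    (F : {mpoly {mpoly k[s]}[l]}) : set ('I_s -> k) :=
  [set tstar | msize (specialize tstar F) = msize F].

(* L is an algebraic closure of K through the embedding iota. *)
Definition algebraic_closure (K : fieldType) (L : closedFieldType)
    (iota : {rmorphism K -> L}) : Prop :=
  forall z : L, algebraicOver iota z.

(* Excludes polynomials such as x_1 (x_1 + x_2): its Newton polygon is a
   segment of lattice length 1, hence not summable in the above sense (a summand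
   {e_1} has a single point), yet it is reducible. *)
Definition no_proper_variable_factor (l : nat) (A : nzRingType)
    (P : {mpoly A[l]}) : Prop :=
  forall (j : 'I_l) (G : {mpoly A[l]}), P = 'X_j * G -> (msize G <= 1)%N.

(* Main.v *)
(** If no coefficient at a vertex of Gamma is lost under specialization, the
    Newton polyhedron of the specialized polynomial P is still Gamma, since a
    polytope is the convex hull of its vertices.  By Ostrowski's theorem a
    factorization P = Q S gives Gamma = N(Q) + N(S), so non-summability forces
    one of the factors to be a monomial.  If it is not constant, some x_j
    divides P; this is visible on Gamma, so x_j divides F as well, and the
    hypothesis on variable factors makes P of degree one.  The cardinality bounds
    count the values of t_i at which some vertex coefficient vanishes. *)
Require Import Defs.
From HB Require Import structures.
From mathcomp Require Import all_boot all_order all_algebra finmap.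
From mathcomp Require Import boolp classical_sets functions cardinality.
From mathcomp Require Import reals convex interval_inference.
From mathcomp Require Import mpoly ring lra.

Set Implicit Arguments.
Unset Strict Implicit.
Unset Printing Implicit Defensive.

Import Order.TTheory GRing.Theory Num.Theory.
Local Open Scope ring_scope.
Local Open Scope classical_set_scope.
Local Open Scope card_scope.

(** * Convex hulls, vertices and Minkowski sums *)

Section ConvexHull.
Variables (R : realType) (l : nat).
Implicit Types (S A B : set 'rV[R]_l) (x y v : 'rV[R]_l).

Lemma convex_setP A :
  @convex_set R 'rV[R]_l A <->
  forall x y (c : R), A x -> A y -> 0 < c -> c < 1 ->
    A (c *: x + (1 - c) *: y).
Proof.
rewrite convex_setW; split => [cA x y c Ax Ay c0 c1|cA x y].
  have := cA x y (mem_set Ax) (mem_set Ay) (Itv01 (ltW c0) (ltW c1)) c0 c1.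
  by rewrite inE.
move=> /set_mem Ax /set_mem Ay c c0 c1; apply/mem_set.
exact: (cA x y c%:num).
Qed.

Lemma convex_hull_convex S : @convex_set R 'rV[R]_l (convex_hull S).
Proof.
apply/convex_setP => x y c Sx Sy c0 c1 A /= [cA SA].
by move/convex_setP: (cA); apply=> //; [apply: Sx|apply: Sy].
Qed.

Arguments convex_hull_convex : clear implicits.

Lemma sub_convex_hull S : S `<=` convex_hull S.
Proof. exact: sub_gen_smallest. Qed.

Lemma convex_hull_min S A :
  @convex_set R 'rV[R]_l A -> S `<=` A -> convex_hull S `<=` A.
Proof. exact: smallest_sub. Qed.

Lemma convex_hullS S A : S `<=` convex_hull A -> convex_hull S `<=` convex_hull A.
Proof. by move=> SA; apply: convex_hull_min => //; exact: convex_hull_convex. Qed.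

(* If v were missing from S, then the hull minus v would still be convex. *)
Lemma vertices_convex_hull S : vertices (convex_hull S) `<=` S.
Proof.
move=> v [hv vV]; apply: contrapT => nSv.
suff : convex_hull S `<=` convex_hull S `\` [set v] by move=> /(_ v hv) [_]; apply.
apply: convex_hull_min; last first.
  by move=> x Sx; split; [exact: sub_convex_hull|move=> /= xv; rewrite -xv in nSv].
apply/convex_setP => x y c [Sx /= xv] [Sy yv] c0 c1; split.
  exact: (convex_setP _).1 (convex_hull_convex S) _ _ _ Sx Sy c0 c1.
(* Extremality of [v] gives [x = y]; the combination, equal to [v], is then [x], which was assumed
   different from [v]. *)
move=> /= e; have xy := vV _ _ _ Sx Sy c0 c1 (esym e).
by apply: xv; rewrite -e -xy -scalerDl addrC subrK scale1r.
Qed.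

(* Outside of H := convex_hull S, the point x is a vertex of the cone over H
   with apex x. *)
Lemma new_point_vertex S x :
  ~ convex_hull S x -> vertices (convex_hull (x |` S)) x.
Proof.
move=> nHx; split; first by apply: sub_convex_hull; left.
pose H := convex_hull S; have cH := (convex_setP _).1 (convex_hull_convex S).
pose C := [set z | z = x \/ exists d y, [/\ 0 < d, H y & z = x + d *: (y - x)]].
have join c d1 d2 y1 y2 : 0 < c -> c < 1 -> 0 < d1 -> 0 < d2 -> H y1 -> H y2 ->
    exists d y, [/\ 0 < d, H y & c *: (x + d1 *: (y1 - x)) +
      (1 - c) *: (x + d2 *: (y2 - x)) = x + d *: (y - x)].
  move=> c0 c1 d10 d20 H1 H2.
  have e1 : 0 < c * d1 by rewrite mulr_gt0.
  have e2 : 0 < (1 - c) * d2 by rewrite mulr_gt0 ?subr_gt0.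
  have e0 : 0 < c * d1 + (1 - c) * d2 by rewrite addr_gt0.
  (* The scales average with weights [c] and [1 - c]; the points [y1] and [y2] average with weights
     proportional to [c * d1] and [(1 - c) * d2]. *)
  exists (c * d1 + (1 - c) * d2),
    ((c * d1 / (c * d1 + (1 - c) * d2)) *: y1 +
     (1 - c * d1 / (c * d1 + (1 - c) * d2)) *: y2); split => //.
    apply: cH => //; first by rewrite divr_gt0.
    by rewrite ltr_pdivrMr // mul1r ltrDl.
  by apply/rowP => j; rewrite !mxE; field; rewrite gt_eqF.
have xSC : convex_hull (x |` S) `<=` C.
  apply: convex_hull_min => [|y [->|Sy]]; [|by left|]; last first.
    right; exists 1, y; split => //; first exact: sub_convex_hull.
    by rewrite scale1r addrC subrK.
  apply/convex_setP => z1 z2 c [->|[d1 [y1 [d10 H1 ->]]]]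
      [->|[d2 [y2 [d20 H2 ->]]]] c0 c1.
  - by left; rewrite -scalerDl addrC subrK scale1r.
  - right; exists ((1 - c) * d2), y2; split => //.
      by rewrite mulr_gt0 ?subr_gt0.
    by apply/rowP => j; rewrite !mxE; ring.
  - right; exists (c * d1), y1; split => //; first by rewrite mulr_gt0.
    by apply/rowP => j; rewrite !mxE; ring.
  - by right; apply: join.
(* Here [x] must lie outside [H]: a positive multiple of [y - x] vanishes only if [y = x]. *)
have nd d y : 0 < d -> H y -> x = x + d *: (y - x) -> False.
  move=> d0 Hy /eqP; rewrite eq_sym addrC -subr_eq0 addrK scaler_eq0 gt_eqF //=.
  by rewrite subr_eq0 => /eqP yx; apply: nHx; rewrite -yx.
move=> z1 z2 c /xSC[->|[d1 [y1 [d10 H1 ->]]]]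
    /xSC[->|[d2 [y2 [d20 H2 ->]]]] c0 c1 // xE; exfalso.
- apply: (nd ((1 - c) * d2) y2 _ H2); first by rewrite mulr_gt0 ?subr_gt0.
  by rewrite {1}xE; apply/rowP => j; rewrite !mxE; ring.
- apply: (nd (c * d1) y1 _ H1); first by rewrite mulr_gt0.
  by rewrite {1}xE; apply/rowP => j; rewrite !mxE; ring.
- have [d [y [d0 Hy e]]] := join _ _ _ _ _ c0 c1 d10 d20 H1 H2.
  by apply: (nd d y d0 Hy); rewrite -e -xE.
Qed.

(** A generator that is not a vertex lies in the hull of the others, by [new_point_vertex], and can
    be discarded; as the list is finite, this ends with vertices only. *)
Lemma convex_hull_vertices (r : seq 'rV[R]_l) :
  convex_hull [set` r] = convex_hull (vertices (convex_hull [set` r])).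
Proof.
apply/seteqP; split; last by apply: convex_hullS => v [].
have [n] := ubnP (size r); elim: n => // n IH in r * => sr.
have [allV|] := pselect (forall x, x \in r -> vertices (convex_hull [set` r]) x).
  by apply: convex_hullS => x /= /allV; exact: sub_convex_hull.
move=> /existsNP[x /not_implyP[xr nVx]]; pose r' := [seq y <- r | y != x].
have rE : [set` r] = x |` [set` r'].
  apply/seteqP; split => y /=; rewrite mem_filter.
    by move=> yr; have [->|yx] := eqVneq y x; [left|right].
  by case=> [->|/andP[]].
have Hx : convex_hull [set` r'] x.
  by apply: contrapT => /new_point_vertex; rewrite -rE.
have hE : convex_hull [set` r] = convex_hull [set` r'].
  rewrite rE; apply/seteqP; split; apply: convex_hullS => y.
    by case=> [->//|]; exact: sub_convex_hull.
  by move=> r'y; apply: sub_convex_hull; right.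
rewrite hE; apply: IH; rewrite size_filter.
move: sr; rewrite ltnS; apply: leq_trans.
by rewrite -(count_predC (pred1 x)) -[X in (X < _)%N]add0n ltn_add2r -has_count has_pred1.
Qed.

Lemma minkowski_sum_convex A B :
  @convex_set R 'rV[R]_l A -> @convex_set R 'rV[R]_l B ->
  @convex_set R 'rV[R]_l (minkowski_sum A B).
Proof.
move=> /convex_setP cA /convex_setP cB; apply/convex_setP.
move=> _ _ c [a Aa [b Bb <-]] [a' Aa' [b' Bb' <-]] c0 c1.
exists (c *: a + (1 - c) *: a'); first exact: cA.
exists (c *: b + (1 - c) *: b'); first exact: cB.
by rewrite !scalerDr addrACA.
Qed.

(** For the inclusion from left to right, hulls are minimal in one summand at a time: first [a] runs
    over the hull of [A] with [b] fixed in [B], then [b] over the hull of [B]. *)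
Lemma minkowski_sum_convex_hull A B :
  minkowski_sum (convex_hull A) (convex_hull B) =
  convex_hull (minkowski_sum A B).
Proof.
apply/seteqP; split; last first.
  apply: convex_hull_min.
    by apply: minkowski_sum_convex; exact: convex_hull_convex.
  move=> _ [a Aa [b Bb <-]].
  by exists a; [exact: sub_convex_hull|exists b => //; exact: sub_convex_hull].
have cH := (convex_setP _).1 (convex_hull_convex (minkowski_sum A B)).
have comb (c : R) z x y :
    z + (c *: x + (1 - c) *: y) = c *: (z + x) + (1 - c) *: (z + y).
  by apply/rowP => j; rewrite !mxE; ring.
have AB b : B b ->
    convex_hull A `<=` [set a | convex_hull (minkowski_sum A B) (b + a)].
  move=> Bb; apply: convex_hull_min => [|a Aa /=].
    by apply/convex_setP => x y c /= hx hy c0 c1; rewrite comb; exact: cH.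
  by apply: sub_convex_hull; exists a => //; exists b => //; rewrite addrC.
move=> _ [a Aa [b Bb <-]].
suff: convex_hull B `<=` [set b | convex_hull (minkowski_sum A B) (a + b)] by apply.
apply: convex_hull_min => [|b' Bb' /=].
  by apply/convex_setP => x y c /= hx hy c0 c1; rewrite comb; exact: cH.
by rewrite addrC; apply: AB.
Qed.

(** The points [a + b'] and [a' + b] have midpoint [a + b], so they coincide; with [a' + b' = a + b]
    this determines both summands. *)
Lemma vertex_minkowski_sum A B a b :
  A a -> B b -> vertices (minkowski_sum A B) (a + b) ->
  forall a' b', A a' -> B b' -> a' + b' = a + b -> a' = a /\ b' = b.
Proof.
move=> Aa Bb [_ vV] a' b' Aa' Bb' e.
have : a + b' = a' + b.
  apply: (vV _ _ (1 / 2%:R)).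
  - by exists a => //; exists b'.
  - by exists a' => //; exists b.
  - lra.
  - lra.
  - move/rowP: e => e; apply/rowP => j; move: (e j); rewrite !mxE; lra.
move=> /rowP e'; move/rowP: e => e.
by split; apply/rowP => j; move: (e j) (e' j); rewrite !mxE; lra.
Qed.

End ConvexHull.

(** * Newton polyhedra and Ostrowski's theorem *)

Section NewtonPolyhedron.
Variables (R : realType) (l : nat).

Lemma expvec_inj : injective (@expvec R l).
Proof.
move=> m m' /rowP e; apply/mnmP => j; move: (e j); rewrite !mxE => /eqP.
by rewrite eqr_nat => /eqP.
Qed.

Lemma expvecD (m m' : 'X_{1..l}) :
  expvec R (m + m')%MM = expvec R m + expvec R m'.
Proof. by apply/rowP => j; rewrite !mxE mnmDE natrD. Qed.

Section Ring.
Variable A : nzRingType.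
Implicit Types P : {mpoly A[l]}.

Lemma newtonE P :
  newton R P = convex_hull [set` [seq expvec R m | m <- msupp P]].
Proof.
congr convex_hull; apply/seteqP; split => v /=.
  by case=> m /= mP <-; apply: map_f.
by move=> /mapP[m mP ->]; exists m.
Qed.

Lemma msupp_newton P m : m \in msupp P -> newton R P (expvec R m).
Proof. by move=> mP; apply: sub_convex_hull; exists m. Qed.

Lemma vertices_newton P v :
  vertices (newton R P) v -> exists2 m, m \in msupp P & expvec R m = v.
Proof. exact: vertices_convex_hull. Qed.

Lemma newton_vertices P :
  newton R P = convex_hull (vertices (newton R P)).
Proof. by rewrite newtonE -convex_hull_vertices. Qed.

(** A half-space is convex. This makes divisibility by the variable [j] visible on the
    polyhedron. *)
Lemma newton_coord_ge1 P (j : 'I_l) :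
  (forall m, m \in msupp P -> (0 < m j)%N) ->
  newton R P `<=` [set v | 1 <= v ord0 j].
Proof.
move=> Pj; apply: convex_hull_min => [|_ [m /= mP <-]].
  by apply/convex_setP => x y c /= hx hy c0 c1; rewrite !mxE; nra.
by rewrite mxE ler1n; apply: Pj.
Qed.

End Ring.

(** The coefficient rings may differ, as they do under specialization. Survival of the vertex
    monomials suffices because the polytope is the hull of its vertices. *)
Lemma newton_sub (A B : nzRingType) (P : {mpoly A[l]}) (Q : {mpoly B[l]}) :
  {subset msupp P <= msupp Q} ->
  (forall m, vertices (newton R Q) (expvec R m) -> m \in msupp P) ->
  newton R P = newton R Q.
Proof.
move=> PQ QP; apply/seteqP; split.
  by apply: convex_hullS => _ [m /= /PQ mQ <-]; apply: msupp_newton.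
rewrite newton_vertices; apply: convex_hullS => v vV.
have [m _ mv] := vertices_newton vV.
by rewrite -mv; apply: msupp_newton; apply: QP; rewrite mv.
Qed.

(* A vertex of the Minkowski sum has a unique decomposition, so its coefficient
   in the product is a single product of nonzero coefficients. *)
Lemma newtonM (A : idomainType) (P Q : {mpoly A[l]}) :
  newton R (P * Q) = minkowski_sum (newton R P) (newton R Q).
Proof.
pose E (T : {mpoly A[l]}) := [seq expvec R m | m <- msupp T].
(* A finite list of generators of the sum, as [convex_hull_vertices] requires. *)
have sumE : minkowski_sum (newton R P) (newton R Q) =
    convex_hull [set` [seq x + y | x <- E P, y <- E Q]].
  rewrite !newtonE minkowski_sum_convex_hull; congr convex_hull.
  apply/seteqP; split => [_ [x xP [y yQ <-]]|v /allpairsP[[x y] /= [xP yQ ->]]].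
    by apply/allpairsP; exists (x, y).
  by exists x => //; exists y.
apply/seteqP; split.
  apply: convex_hull_min.
    by apply: minkowski_sum_convex; exact: convex_hull_convex.
  move=> _ [m /= /msuppM_le/allpairsP[[a b] /= [aP bQ ->]] <-].
  by exists (expvec R a); [|exists (expvec R b); rewrite ?expvecD];
    try exact: msupp_newton.
rewrite {1}sumE convex_hull_vertices -sumE; apply: convex_hullS => v vV.
have : [set` [seq x + y | x <- E P, y <- E Q]] v.
  by apply: vertices_convex_hull; rewrite -sumE.
move=> /= /allpairsP[[_ _] /= [/mapP[a aP ->] /mapP[b bQ ->] vE]].
have uniq_ab a' b' : a' \in msupp P -> b' \in msupp Q ->
    (a' + b')%MM = (a + b)%MM -> a' = a /\ b' = b.
  move=> aP' bQ' e; rewrite vE in vV.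
  have e' : expvec R a' + expvec R b' = expvec R a + expvec R b.
    by rewrite -!expvecD e.
  by have [/expvec_inj -> /expvec_inj ->] := vertex_minkowski_sum
    (msupp_newton aP) (msupp_newton bQ) vV
    (msupp_newton aP') (msupp_newton bQ') e'.
rewrite vE -expvecD; apply: msupp_newton.
rewrite mcoeff_msupp [P * Q]mpolyME raddf_sum /=.
rewrite big_allpairs (bigD1_seq a) //= (bigD1_seq b) //= !mcoeffZ.
rewrite mcoeffX eqxx mulr1 [X in _ + X + _]big1_seq ?addr0; last first.
  move=> b' /andP[bb bQ']; rewrite mcoeffZ mcoeffX; case: eqP => [e|]; last first.
    by rewrite mulr0.
  by have [_ e'] := uniq_ab _ _ aP bQ' e; rewrite e' eqxx in bb.
rewrite [X in _ + X]big1_seq ?addr0; last first.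
  move=> a' /andP[aa aP']; rewrite big1_seq // => b' bQ'.
  rewrite mcoeffZ mcoeffX; case: eqP => [e|]; last by rewrite mulr0.
  by have [e' _] := uniq_ab _ _ aP' bQ' e; rewrite e' eqxx in aa.
by rewrite mulf_neq0 // -mcoeff_msupp.
Qed.

End NewtonPolyhedron.
Arguments msupp_newton R {l A P m}.

(** * Units and variable factors of polynomials *)

Lemma mpoly_unitE (l : nat) (L : fieldType) (P : {mpoly L[l]}) :
  (P \is a GRing.unit) = (msize P == 1%N).
Proof.
apply/idP/msize_poly1P => [|[c c0 ->]].
  rewrite unfold_in => /andP[/eqP PE]; rewrite unitfE => P0.
  by exists P@_0.
by rewrite rmorph_unit ?unitfE.
Qed.

Lemma mpolyX_factor (l : nat) (A : comNzRingType) (F : {mpoly A[l]}) (j : 'I_l) :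
  (forall m, m \in msupp F -> (0 < m j)%N) -> exists G, F = 'X_j * G.
Proof.
(* Subtraction of exponents is truncated; it is exact here because every exponent at [j] is
   positive. *)
move=> Fj; exists (\sum_(m <- msupp F) F@_m *: 'X_[m - U_(j)]).
rewrite {1}[F]mpolyE big_distrr /=; apply: eq_big_seq => m mF.
rewrite -scalerAr -mpolyXD addmC submK //.
by apply/mnm_lepP => i; rewrite mnm1E; case: eqP => // <-; apply: Fj.
Qed.

(** * Irreducibility when the vertex monomials survive *)

Section Irreducibility.
Variables (R : realType) (l : nat) (A : idomainType) (L : fieldType).
(** [P] stands for a specialization of [F] over any field, so that one argument serves both [k] and
    the closure of a function field. *)
Variables (F : {mpoly A[l]}) (P : {mpoly L[l]}).
Hypothesis sF : (1 < msize F)%N.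
Hypothesis hX : no_proper_variable_factor F.
Hypothesis hG : ~ summable (newton R F).
Hypothesis sPF : {subset msupp P <= msupp F}.
Hypothesis vP : forall m, vertices (newton R F) (expvec R m) -> m \in msupp P.

Let newtonPF : newton R P = newton R F := newton_sub sPF vP.

Let F0 : F != 0.
Proof. by rewrite -msize_poly_eq0; case: (msize F) sF. Qed.

(** The polyhedron of 0 is the hull of the empty set, hence empty, whereas that of [F] contains an
    exponent. *)
Let P0 : P != 0.
Proof.
apply/eqP => P0.
have /hasP[m mF _] : has predT (msupp F).
  by rewrite has_predT; case: (msupp F) (msupp_eq0 F) F0 => //= <-.
have := msupp_newton R mF; rewrite -newtonPF newtonE P0 msupp0 /=.
by move=> /(_ set0) [] //; split => //; apply/convex_setP.
Qed.

Let PFj (j : 'I_l) :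
  (forall m, m \in msupp P -> (0 < m j)%N) ->
  forall m, m \in msupp F -> (0 < m j)%N.
Proof.
move=> /(@newton_coord_ge1 R) hP m mF.
have /hP : newton R P (expvec R m) by rewrite newtonPF; apply: msupp_newton.
by rewrite /= mxE ler1n.
Qed.

Let sPleF : (msize P <= msize F)%N.
Proof.
rewrite [msize P]msizeE; apply/bigmax_leqP_seq => m mP _.
by apply: msize_mdeg_lt; apply: sPF.
Qed.

(** A nonconstant [Q] with single exponent [u] makes some variable divide [P], hence [F], with
    constant cofactor by [hX]. So [P] has degree at most one, all of it taken up by [Q]. *)
Let monomial_cofactor (Q S : {mpoly L[l]}) (u : 'X_{1..l}) :
  P = Q * S -> (forall m, m \in msupp Q -> m = u) ->
  Q \isn't a GRing.unit -> S \is a GRing.unit.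
Proof.
move=> PE Qu; rewrite !mpoly_unitE => nQ.
have [Q0 S0] : Q != 0 /\ S != 0.
  by apply/andP; rewrite -negb_or -mulf_eq0 -PE.
have sQ : (1 < msize Q)%N.
  by rewrite ltn_neqAle eq_sym nQ lt0n msize_poly_eq0.
have /existsP[j uj] : [exists j, 0 < u j]%N.
  apply: contraTT sQ; rewrite negb_exists -leqNgt => /forallP hu.
  rewrite msizeE; apply/bigmax_leqP_seq => m /Qu -> _.
  rewrite ltnS leqn0 mdeg_eq0; apply/eqP/mnmP => j.
  by apply/eqP; rewrite mnm0E -leqn0 leqNgt.
have Pj m : m \in msupp P -> (0 < m j)%N.
  rewrite PE => /msuppM_le /allpairsP[[a b] /= [/Qu -> _ ->]].
  by rewrite mnmDE ltn_addr.
have [G FE] := mpolyX_factor (PFj Pj).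
have sG := hX FE.
have G0 : G != 0 by apply: contraNneq F0 => G0; rewrite FE G0 mulr0.
have : (msize P <= 2)%N.
  apply: leq_trans sPleF _; rewrite FE msizeM //; last first.
    by rewrite -msize_poly_eq0 msizeX.
  by rewrite msizeX mdeg1 add2n.
rewrite PE msizeM // => sP.
have : (0 < msize S)%N by rewrite lt0n msize_poly_eq0.
by case: (msize Q) (msize S) sQ sP => [|[|q]] // [|[|t]] //=; rewrite !addnS.
Qed.

Lemma irreducible_of_vertices : irreducible_elt P.
Proof.
split => //.
  (* A constant [P] would confine the common polyhedron to the origin, making [F] constant in x. *)
  apply/negP; rewrite mpoly_unitE => /eqP sP.
  have Pz m : m \in msupp P -> m = 0%MM.
    by move/msize_mdeg_lt; rewrite sP ltnS leqn0 mdeg_eq0 => /eqP.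
  have F_cst : newton R F `<=` [set 0].
    rewrite -newtonPF; apply: convex_hull_min => [|_ [m /= /Pz -> <-]].
      by apply/convex_setP => x y c /= -> -> _ _; rewrite !scaler0 addr0.
    by apply/rowP => j; rewrite !mxE mnm0E.
  move: sF; rewrite ltnNge => /negP; apply.
  rewrite msizeE; apply/bigmax_leqP_seq => m /(msupp_newton R)/F_cst /= e _.
  rewrite ltnS leqn0 mdeg_eq0; apply/eqP/mnmP => j.
  by move/rowP: e => /(_ j); rewrite !mxE mnm0E => /eqP; rewrite pnatr_eq0 => /eqP.
move=> Q S PE.
have [uQ|nQ] := boolP (Q \is a GRing.unit); first by left.
have [uS|nS] := boolP (S \is a GRing.unit); [by right|exfalso].
(* If [T] had a single exponent, [monomial_cofactor] would make [U] a unit. *)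
have two (T U : {mpoly L[l]}) : P = T * U -> T \isn't a GRing.unit ->
    U \isn't a GRing.unit ->
    exists a a', [/\ newton R T a, newton R T a' & a <> a'].
  move=> PTU nT nU; apply: contrapT => h.
  have T0 : T != 0 by apply: contraNneq P0 => T0; rewrite PTU T0 mul0r.
  have /hasP[u uT _] : has predT (msupp T).
    by rewrite has_predT; case: (msupp T) (msupp_eq0 T) T0 => //= <-.
  move/negP: nU; apply; apply: (@monomial_cofactor T U u) => // m mT.
  apply: contrapT => mu; apply: h; exists (expvec R m), (expvec R u).
  by split; try exact: msupp_newton; move=> /expvec_inj.
apply: hG; exists (newton R Q), (newton R S); split.
- by split; exact: convex_hull_convex.
- by split => v /vertices_newton[m _ <-]; exists m.
- exact: (two Q S).
- by apply: (two S Q) => //; rewrite mulrC.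
- by rewrite -newtonPF PE newtonM.
Qed.

End Irreducibility.

(** * Substituting a value for one parameter *)

Definition drop_var (s : nat) (i : 'I_s) (u : 'X_{1..s}) : 'X_{1..s.-1} :=
  [multinom u (lift i j) | j < s.-1].

Lemma drop_var_inj (s : nat) (i : 'I_s) (u v : 'X_{1..s}) :
  drop_var i u = drop_var i v -> u i = v i -> u = v.
Proof.
move=> /mnmP duv uvi; apply/mnmP => j.
have [j' ->|->//] := unliftP i j.
by move: (duv j'); rewrite !mnmE.
Qed.

(** The coefficient map of [specialize1], isolated to be studied on a single coefficient. *)
Definition subst_var (k : comNzRingType) (s : nat) (i : 'I_s) (a : k) :
    {mpoly k[s]} -> {mpoly k[s.-1]} :=
  comp_mpoly [tuple if unlift i j is Some j' then 'X_j' else a%:MP | j < s].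

Lemma subst_varE (k : comNzRingType) (s : nat) (i : 'I_s) (a : k)
    (h : {mpoly k[s]}) :
  subst_var i a h =
    \sum_(u <- msupp h) (h@_u * a ^+ u i) *: 'X_[drop_var i u].
Proof.
case: s => [|s] in i h *; first by case: i.
rewrite /subst_var comp_mpolyE; apply: eq_bigr => u _.
rewrite (bigD1_ord i) //= tnth_mktuple unlift_none -rmorphXn /=.
rewrite mul_mpolyC scalerA mpolyXE_id; congr (_ *: _).
by apply: eq_bigr => j _; rewrite tnth_mktuple liftK mnmE.
Qed.

(** Some coefficient of [subst_var i a h] is a nonzero polynomial in [a], of degree at most that of
    [h] in the variable [i]; its roots with multiplicity form [r]. *)
Lemma roots_subst_var (k : closedFieldType) (s : nat) (i : 'I_s)
    (h : {mpoly k[s]}) :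
  h != 0 -> exists2 r : seq k, (size r <= \max_(u <- msupp h) u i)%N &
    forall a, subst_var i a h = 0 -> a \in r.
Proof.
move=> h0.
have /hasP[w wh _] : has predT (msupp h).
  by rewrite has_predT; case: (msupp h) (msupp_eq0 h) h0 => //= <-.
(* The coefficient of [subst_var i a h] at [drop_var i w], as a polynomial in a. *)
pose p : {poly k} :=
  \sum_(u <- msupp h | drop_var i u == drop_var i w) h@_u *: 'X^(u i).
have pE a : (subst_var i a h)@_(drop_var i w) = p.[a].
  rewrite subst_varE raddf_sum horner_sum /= [RHS]big_mkcond.
  apply: eq_bigr => u _; rewrite mcoeffZ mcoeffX; case: eqP => _.
    by rewrite mulr1 hornerZ hornerXn.
  by rewrite mulr0.
(* The coefficient of [p] at [w i] is [h@_w]: an exponent is determined by its [drop_var] and its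
   entry at [i]. *)
have p0 : p != 0.
  apply/eqP => /(congr1 (fun q : {poly k} => q`_(w i))).
  rewrite coef0 coef_sum -big_filter (bigD1_seq w) ?filter_uniq //=; last first.
    by rewrite mem_filter eqxx.
  rewrite coefZ coefXn eqxx mulr1 big1_seq ?addr0.
    by apply/eqP; rewrite -mcoeff_msupp.
  move=> u /andP[uw]; rewrite mem_filter => /andP[/eqP du _].
  rewrite coefZ coefXn; case: eqP => [e|]; last by rewrite mulr0.
  by rewrite (drop_var_inj du (esym e)) eqxx in uw.
have [r rE] := closed_field_poly_normal p.
exists r => [|a ha].
  have sp : size p = (size r).+1.
    by rewrite rE size_scale ?lead_coef_eq0 // size_prod_XsubC.
  rewrite -ltnS -sp; apply: leq_trans (size_sum _ _ _) _.
  apply/bigmax_leqP_seq => u uh _; apply: leq_trans (size_scale_leq _ _) _.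
  by rewrite size_polyXn ltnS; apply: leq_bigmax_seq.
have : root p a by rewrite rootE -pE ha mcoeff0.
by rewrite rE rootZ ?lead_coef_eq0 // root_prod_XsubC.
Qed.

(** Evaluation in two stages, linking full specializations to the roots found for [subst_var]. *)
Lemma meval_subst_var (k : comNzRingType) (s : nat) (i : 'I_s) (t : 'I_s -> k)
    (h : {mpoly k[s]}) :
  (subst_var i (t i) h).@[t \o lift i] = h.@[t].
Proof.
rewrite comp_mpoly_meval; apply: meval_eq => j; rewrite tnth_mktuple.
by case: unliftP => [j' ->|->]; rewrite ?mevalXU ?mevalC.
Qed.

(** The equation [n = 0] is a hypothesis so that the lemma applies to [s.-1] when [s = 1] is only a
    proved equality. *)
Lemma meval_eq0_novar (k : comNzRingType) (n : nat) (v : 'I_n -> k)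
    (h : {mpoly k[n]}) :
  n = 0%N -> h.@[v] = 0 -> h = 0.
Proof.
move=> n0; subst n; have m0 (m : 'X_{1..0}) : m = 0%MM by apply/mnmP => -[].
have hE : h = (h@_0)%:MP by apply/mpolyP => m; rewrite (m0 m) mcoeffC eqxx mulr1.
by rewrite hE mevalC => ->; rewrite mpolyC0.
Qed.

(** * Counting the roots of the vertex coefficients *)

Lemma card_le_seq (T : Type) (U : eqType) (f : T -> U) (D : set T) (r : seq U)
    (n : nat) :
  {in D &, injective f} -> (forall x, D x -> f x \in r) -> (size r <= n)%N ->
  D #<= `I_n.
Proof.
move=> f_inj Dr rn; apply/pcard_leP/injfunPex; exists (fun x => index (f x) r).
  by move=> x /Dr xr /=; apply: leq_trans rn; rewrite index_mem.
move=> x y xD yD /(congr1 (nth (f x) r)).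
by rewrite !nth_index; [exact: f_inj|exact/Dr/set_mem|exact/Dr/set_mem].
Qed.

(** Each vertex is the image of exactly one exponent of [F]; the count becomes the length of a list,
    fit for induction. *)
Lemma card_vertices_newton (R : realType) (l : nat) (A : nzRingType)
    (F : {mpoly A[l]}) :
  size [seq m <- msupp F | `[< vertices (newton R F) (expvec R m) >]] =
  #|` fset_set (vertices (newton R F))|.
Proof.
set r := [seq m <- _ | _].
have -> : vertices (newton R F) = [set` [fset v in [seq expvec R m | m <- r]]%fset].
  apply/seteqP; split => v /=; rewrite !inE.
    move=> vV; have [m mF mv] := vertices_newton vV.
    by rewrite -mv map_f // mem_filter mF andbT; apply/asboolP; rewrite mv.
  by case/mapP => m; rewrite mem_filter => /andP[/asboolP ? _] ->.
rewrite set_fsetK card_fseq undup_id ?size_map //.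
by rewrite map_inj_uniq ?filter_uniq //; exact: expvec_inj.
Qed.

(** The list concatenates, over the vertices, the roots attached to each vertex coefficient; each
    contributes at most [degt i F] values. *)
Lemma vertex_coefficient_roots (R : realType) (k : closedFieldType) (l s : nat)
    (F : {mpoly {mpoly k[s]}[l]}) (i : 'I_s) :
  exists2 r : seq k,
    (size r <= #|` fset_set (vertices (newton R F))| * degt i F)%N &
    forall a m, vertices (newton R F) (expvec R m) ->
      subst_var i a F@_m = 0 -> a \in r.
Proof.
rewrite -card_vertices_newton; set r := [seq m <- _ | _].
have rF : {subset r <= msupp F} by move=> m; rewrite mem_filter => /andP[].
suff [r' sr' r'P] : exists2 r' : seq k, (size r' <= size r * degt i F)%N &
    forall a m, m \in r -> subst_var i a F@_m = 0 -> a \in r'.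
  exists r' => // a m vm; apply: r'P; rewrite mem_filter; apply/andP; split.
    exact/asboolP.
  by have [m' m'F /expvec_inj <-] := vertices_newton vm.
elim: r rF => [|m r IH] rF; first by exists [::].
have [|r' sr' r'P] := IH; first by move=> x xr; apply: rF; rewrite inE xr orbT.
have mF : m \in msupp F by apply: rF; rewrite mem_head.
have [|rm srm rmP] := @roots_subst_var k s i F@_m; first by rewrite -mcoeff_msupp.
exists (rm ++ r') => [|a m'].
  rewrite size_cat mulSn leq_add //; apply: leq_trans srm _.
  by rewrite /degt (big_rem m) //= leq_maxl.
rewrite inE mem_cat => /orP[/eqP -> /rmP ->//|m'r /(r'P _ _ m'r) ->].
by rewrite orbT.
Qed.

(** * Irreducible specializations and the two cardinality bounds *)

Theorem proposition1p1 (R : realType) (k : closedFieldType) (l s : nat)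
    (hl : (2 <= l)%N) (hs : (1 <= s)%N)
    (F : {mpoly {mpoly k[s]}[l]})
    (hF : (1 < msize F)%N) (hX : no_proper_variable_factor F)
    (hGamma : ~ summable (newton R F)) :
  [/\ (forall tstar : 'I_s -> k,
         (forall m : 'X_{1..l}, vertices (newton R F) (expvec R m) ->
            (F@_m).@[tstar] != 0) ->
         irreducible_elt (specialize tstar F)),
      (s = 1%N -> forall i : 'I_s,
         sp F `&` degree_preserving F
           #<= `I_(#|` fset_set (vertices (newton R F))| * degt i F))
    & (forall (i : 'I_s) (L : closedFieldType)
         (iota : {rmorphism {fraction {mpoly k[s.-1]}} -> L}),
         algebraic_closure iota ->
         [set a : k | msize (specialize1 i a F) = msize F /\
            reducible_elt
              (map_mpoly (iota \o @tofrac _) (specialize1 i a F))]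
           #<= `I_(#|` fset_set (vertices (newton R F))| * degt i F))].
Proof.
have irr tstar : (forall m : 'X_{1..l}, vertices (newton R F) (expvec R m) ->
    (F@_m).@[tstar] != 0) -> irreducible_elt (specialize tstar F).
  move=> ht; apply: irreducible_of_vertices hF hX hGamma _ _ => m.
    rewrite !mcoeff_msupp mcoeff_map_mpoly; apply: contraNneq => ->.
    by apply/eqP/meval0.
  by move=> /ht; rewrite mcoeff_msupp mcoeff_map_mpoly.
split=> //.
  move=> s1 i; have [r sr rP] := vertex_coefficient_roots R F i.
  (* For [s = 1], [i] is the only index, so counting points amounts to counting their coordinate at
     [i]. *)
  have inj_t : injective (fun t : 'I_s -> k => t i).
    move=> t t' /= e; apply/funext => j; suff -> : j = i by [].
    apply: val_inj; case: i j {r sr rP e} => [i hi] [j hj] /=.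
    by move: hi hj; rewrite s1; case: i j => [|?] [|?].
  apply: card_le_seq sr; first exact: in2W inj_t.
  move=> t [/= [Q [S [nQ nS tE]]] _].
  have [m vm hm] : exists2 m, vertices (newton R F) (expvec R m) & (F@_m).@[t] = 0.
    apply: contrapT => h; have [|_ _ /(_ Q S tE)] := irr t.
      by move=> m vm; apply/eqP => hm; apply: h; exists m.
    by rewrite (negPf nQ) (negPf nS) => -[].
  (* Once [t i] is substituted no variable remains, so a zero value means a zero polynomial. *)
  apply: rP vm _; apply: (@meval_eq0_novar _ _ (t \o lift i)).
    by rewrite s1.
  by rewrite meval_subst_var.
move=> i L iota _; have [r sr rP] := vertex_coefficient_roots R F i.
apply: (card_le_seq (f := id)) sr => // a [_ [Q [S [nQ nS aE]]]].
apply: contrapT => nar.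
(* The map into [L] is injective, so a vertex coefficient vanishes there only if [subst_var] already
   kills it. *)
have iota_eq0 (h : {mpoly k[s.-1]}) : (iota (tofrac h) == 0) = (h == 0).
  by rewrite fmorph_eq0 tofrac_eq0.
have [||_ _ /(_ Q S aE)] := irreducible_of_vertices hF hX hGamma
    (P := map_mpoly (iota \o @tofrac _) (specialize1 i a F)).
- move=> m; rewrite !mcoeff_msupp !mcoeff_map_mpoly /= iota_eq0.
  by apply: contraNneq => ->; apply/eqP; exact: comp_mpoly0.
- move=> m vm; rewrite mcoeff_msupp !mcoeff_map_mpoly /= iota_eq0.
  by apply/eqP => hm; apply: nar; apply: rP vm hm.
- by rewrite (negPf nQ) (negPf nS) => -[].
Qed.
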